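(* For every finite median graph $\Gamma=(V,E)$ there exist a finite set $Y$ with $|Y|\le|V|$ and a closed Condorcet domain $\mathcal{D}\subseteq\mathcal{R}(Y)$ such that the associated graph $\Gamma_{\mathcal{D}}$ is isomorphic to $\Gamma$.
   Context: A median graph is a connected graph in which for any three vertices $u,v,w$ there is a unique vertex lying simultaneously on some shortest $u$–$v$, $u$–$w$ and $v$–$w$ paths. $\mathcal{R}(Y)$ is the set of strict linear orders on $Y$. A profile over $\mathcal{D}$ is $(R_1,\dots,R_n)\in\mathcal{D}^n$, odd if $n$ is odd; its majority relation ranks $x$ above $y$ iff more than half of the voters do. $\mathcal{D}$ is a Condorcet domain if every such majority relation is acyclic, and closed if the majority relation of every odd profile over $\mathcal{D}$ belongs to $\mathcal{D}$. For $R,R'\in\mathcal{R}(Y)$ let $[R,R']=\{Q\in\mathcal{R}(Y): Q\supseteq R\cap R'\}$; $\Gamma_{\mathcal{D}}$ is the graph on $\mathcal{D}$ in which distinct $R,R'$ are adjacent iff $[R,R']\cap\mathcal{D}=\{R,R'\}$. *)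

(* Defs.v *)
From mathcomp Require Import all_boot.

Set Implicit Arguments.
Unset Strict Implicit.
Unset Printing Implicit Defensive.

Section Graphs.
Variables (V : finType) (E : rel V).

Definition simple_graph : Prop := symmetric E /\ irreflexive E.

Definition connected : Prop := forall u v : V, connect E u v.

(* The sequence p omits the starting vertex u, so size p is the number of
   edges traversed. *)
Definition walk (u v : V) (p : seq V) : Prop := path E u p /\ last u p = v.

(* A walk of minimum length is automatically a (simple) path. *)
Definition shortest_path (u v : V) (p : seq V) : Prop :=
  walk u v p /\ forall q, walk u v q -> size p <= size q.

Definition on_shortest_path (u v m : V) : Prop :=
  exists p, shortest_path u v p /\ m \in u :: p.

Definition median_graph : Prop :=
  [/\ simple_graph, connected &
   forall u v w : V, exists! m : V,
     [/\ on_shortest_path u v m,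
         on_shortest_path u w m &
         on_shortest_path v w m]].

End Graphs.

Definition graph_isomorphic (S T : Type) (e : rel S) (e' : rel T) : Prop :=
  exists f : S -> T, bijective f /\ forall x y, e' (f x) (f y) = e x y.

Section Domains.
Variable Y : finType.

(* A binary relation on Y is its set of ordered pairs; (x, y) \in R means
   that R ranks x above y. *)
Definition relation : finType := {set Y * Y}.

Definition linear_orders : {set relation} :=
  [set R : relation |
    [&& [forall x, (x, x) \notin R],
        [forall x, forall y, forall z,
          ((x, y) \in R) && ((y, z) \in R) ==> ((x, z) \in R)] &
        [forall x, forall y, (x != y) ==> ((x, y) \in R) || ((y, x) \in R)]]].

Definition profile_over (D : {set relation}) (n : nat)
    (P : 'I_n -> relation) : Prop :=
  forall i, P i \in D.

Definition majority (n : nat) (P : 'I_n -> relation) : relation :=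
  [set xy : Y * Y | n < 2 * #|[set i : 'I_n | xy \in P i]|].

(* The empty sequence is vacuously a cycle for path.cycle. *)
Definition acyclic (R : relation) : Prop :=
  forall s : seq Y, cycle [rel x y | (x, y) \in R] s -> s = [::].

Definition condorcet_domain (D : {set relation}) : Prop :=
  D \subset linear_orders /\
  forall (n : nat) (P : 'I_n -> relation),
    profile_over D P -> acyclic (majority P).

Definition closed_domain (D : {set relation}) : Prop :=
  forall (n : nat) (P : 'I_n -> relation),
    odd n -> profile_over D P -> majority P \in D.

Definition interval (R R' : relation) : {set relation} :=
  [set Q in linear_orders | R :&: R' \subset Q].

Definition domain_graph (D : {set relation}) : rel {R : relation | R \in D} :=
  fun R R' =>
    (R != R') && (interval (val R) (val R') :&: D == [set val R; val R']).

End Domains.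

(* Main.v *)
(** Fix a root [b] and a parent of every other vertex one step closer to [b].
For an edge [uv], the vertices nearer to [u] than to [v] form a halfspace: in a
median graph this set and its complement are convex. The halfspaces of the
edges from the vertices [v != b] to their parents separate all vertices, so
they encode each vertex [x] by bits indexed by [v != b]. Order [V] with [b]
last; the linear order attached to [x] places [v] above or below all later
elements according to the bit of [x] at [v]. Majorities and intervals of such
orders are computed bitwise. Odd majorities are realized by a vertex that
minimizes the sum of the distances to the voters, and adjacency says that the
box spanned by two bit vectors contains no third vertex. *)
Require Import Defs.
From mathcomp Require Import all_boot.
From mathcomp Require Import zify.

Set Implicit Arguments.
Unset Strict Implicit.
Unset Printing Implicit Defensive.

(** * Distance and betweenness in a connected graph *)

Section Distance.
Variables (V : finType) (E : rel V) (symE : symmetric E) (conE : connected E).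

(** Tuples of fixed length make the existence of a walk boolean, as [ex_minn] requires. *)
Definition has_walk (u v : V) (n : nat) : bool :=
  [exists t : n.-tuple V, path E u t && (last u t == v)].

Lemma has_walkP u v n :
  reflect (exists p, walk E u v p /\ size p = n) (has_walk u v n).
Proof.
apply: (iffP existsP) => [[t /andP[pt /eqP lt]]|[p [[pp lp] <-]]].
  by exists t; rewrite size_tuple.
by exists (in_tuple p); rewrite /= pp lp eqxx.
Qed.

Lemma has_walk_exists u v : exists n, has_walk u v n.
Proof.
have /connectP[p pp ->] := conE u v.
by exists (size p); apply/has_walkP; exists p.
Qed.

Definition dist (u v : V) : nat := ex_minn (has_walk_exists u v).

Lemma dist_walk u v : exists p, walk E u v p /\ size p = dist u v.
Proof. by rewrite /dist; case: ex_minnP => n /has_walkP. Qed.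

Lemma dist_le u v p : walk E u v p -> dist u v <= size p.
Proof.
move=> wp; rewrite /dist; case: ex_minnP => n _; apply.
by apply/has_walkP; exists p.
Qed.

Lemma walk_cat u v w p q : walk E u v p -> walk E v w q -> walk E u w (p ++ q).
Proof. by move=> [pp <-] [pq <-]; split; rewrite ?last_cat // cat_path pp. Qed.

Lemma dist_triangle v u w : dist u w <= dist u v + dist v w.
Proof.
have [p [wp <-]] := dist_walk u v; have [q [wq <-]] := dist_walk v w.
by rewrite -size_cat dist_le //; apply: walk_cat wq.
Qed.

Lemma distxx u : dist u u = 0.
Proof. by apply/eqP; rewrite -leqn0; exact: (@dist_le u u [::]). Qed.

Lemma dist_eq0 u v : dist u v = 0 -> u = v.
Proof. by have [p [[_ <-] <-]] := dist_walk u v; case: p. Qed.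

Lemma dist_edge_le u v : E u v -> dist u v <= 1.
Proof. by move=> uv; apply: (@dist_le u v [:: v]); split; rewrite /= ?uv. Qed.

Lemma distC u v : dist u v = dist v u.
Proof.
suff le x y : dist x y <= dist y x by apply/eqP; rewrite eqn_leq !le.
have [p [[+ <-] <-]] := dist_walk y x.
elim: p y => [|z p IHp] y /=; first by rewrite distxx.
case/andP=> yz /IHp; have := dist_triangle z (last z p) y.
by have := @dist_edge_le z y; rewrite symE => /(_ yz); lia.
Qed.

Lemma dist_step u v : u != v -> exists2 w, E u w & dist u v = (dist w v).+1.
Proof.
have [[|w p] [[pp lp] sp]] := dist_walk u v; first by rewrite -lp eqxx.
move: pp lp => /= /andP[uw pp] lp _; exists w => //.
have := dist_triangle w u v; have := dist_edge_le uw.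
have := @dist_le w v p (conj pp lp); move: sp => /=; lia.
Qed.

Lemma dist1_edge u v : dist u v = 1 -> E u v.
Proof.
have [->|/dist_step[w uw ->]] := eqVneq u v; first by rewrite distxx.
by case=> /dist_eq0 <-.
Qed.

Definition between (u m v : V) : bool := dist u m + dist m v == dist u v.

Lemma on_shortest_pathP u v m :
  on_shortest_path E u v m <-> between u m v.
Proof.
split=> [[p [[wp minp] mp]]|/eqP uv].
  have sp : size p <= dist u v.
    by have [q [wq <-]] := dist_walk u v; apply: minp.
  case/splitPl: mp wp sp => p1 p2 lp1 [+ +].
  rewrite cat_path last_cat lp1 size_cat => /andP[pp1 pp2] lp2.
  have := dist_le (conj pp1 lp1); have := dist_le (conj pp2 lp2).
  by have := dist_triangle m u v; rewrite /between; lia.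
have [p [wp sp]] := dist_walk u m; have [q [wq sq]] := dist_walk m v.
exists (p ++ q); split; last by rewrite -cat_cons mem_cat -wp.2 mem_last.
split; first exact: walk_cat wq.
by move=> r /dist_le; rewrite size_cat sp sq uv.
Qed.

End Distance.

(** * Convexity and halfspaces in a median graph *)

Section MedianGraph.
Variables (V : finType) (E : rel V).
Variables (symE : symmetric E) (irrE : irreflexive E) (conE : connected E).

Local Notation d := (dist conE).
Local Notation btw := (between conE).

Variable medE : forall u v w : V, exists! m : V,
  [/\ on_shortest_path E u v m, on_shortest_path E u w m &
      on_shortest_path E v w m].

Lemma median_exists u v w : exists m, [/\ btw u m v, btw u m w & btw v m w].
Proof.
by have [m [[? ? ?] _]] := medE u v w; exists m; split;
  apply/(on_shortest_pathP conE).
Qed.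

Lemma median_unique u v w m m' :
  btw u m v -> btw u m w -> btw v m w ->
  btw u m' v -> btw u m' w -> btw v m' w -> m = m'.
Proof.
move=> ? ? ? ? ? ?; have [m0 [_ uniq_m0]] := medE u v w.
by rewrite -(uniq_m0 m) ?(uniq_m0 m') //; split;
  apply/(on_shortest_pathP conE).
Qed.

Lemma dist_edge u v : E u v -> d u v = 1.
Proof.
move=> uv; have := dist_edge_le conE uv; case h: (d u v) => [|[|n]] // _.
by move/dist_eq0: h uv => ->; rewrite irrE.
Qed.

(** The median of [x], [u], [v] lies between [u] and [v], so it is one of these ends and lies
    between [x] and the other. *)
Lemma edge_dist_succ u v x : E u v -> d x v = (d x u).+1 \/ d x u = (d x v).+1.
Proof.
move=> uv; have [m [/eqP h1 /eqP h2 /eqP h3]] := median_exists x u v.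
have duv := dist_edge uv; have du := distC symE conE m u.
have [m0|m0] : d u m = 0 \/ d m v = 0 by lia.
- by move/dist_eq0: m0 h2 => <-; rewrite duv; lia.
- by move: h1; rewrite (dist_eq0 m0) (distC symE conE v u) duv; lia.
Qed.

Lemma nearer_between_end u v x z :
  E u v -> d x u < d x v -> btw x z u -> d z u < d z v.
Proof.
move=> uv xu /eqP xz; have := dist_triangle conE z x v; lia.
Qed.

(* If w were nearer to v, then w and the median of x, y, u would both be
   medians of x, y, v. *)
Lemma nearer_common_neighbour u v x y w :
  E u v -> E x w -> E w y -> d x y = 2 ->
  d x u < d x v -> d y u < d y v -> d w u < d w v.
Proof.
move=> uv xw wy dxy xu yu; rewrite ltnNge; apply/negP => wv.
have dxw := dist_edge xw; have dwy := dist_edge wy; have duv := dist_edge uv.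
have sx := edge_dist_succ x uv; have sy := edge_dist_succ y uv.
have sw := edge_dist_succ w uv.
have t1 := dist_triangle conE w x v; have t2 := dist_triangle conE x w u.
have t3 := dist_triangle conE w y v; have t4 := dist_triangle conE y w u.
have c1 := distC symE conE w x; have c2 := distC symE conE w y.
have [m [/eqP h1 /eqP h2 /eqP h3]] := median_exists x y u.
have c3 := distC symE conE m y.
have t5 := dist_triangle conE u m v.
have t6 := dist_triangle conE m x v; have t7 := dist_triangle conE m y v.
(* Here [w] is farther from [u] than [x] is, so [w] is not between [x] and [u], and [m = w] is
   absurd. *)
suff mw : m = w by move: h2; rewrite mw; lia.
by apply: (@median_unique x y v); rewrite /between; lia.
Qed.

(* Induction on d x y: let x' be the neighbour of x towards z. If x is not
   between y and u, some neighbour x2 of x is nearer both to y and to u; the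
   median w of x', x2, y then makes x' a common neighbour of x and w, which
   both lie on the side of u. *)
Lemma nearer_convex u v x y z :
  E u v -> d x u < d x v -> d y u < d y v -> btw x z y -> d z u < d z v.
Proof.
move=> uv; have [n] := ubnP (d x y); elim: n x y z => // n IHn x y z.
rewrite ltnS => xy xu yu.
have [<- //|zx] := eqVneq x z; move=> /eqP xzy.
have [x' xx' dx'] := dist_step conE zx.
have dxx' := dist_edge xx'.
have tx := dist_triangle conE x' x y; have tz := dist_triangle conE z x' y.
suff x'u : d x' u < d x' v.
  by apply: (IHn x' y) => //; rewrite /between; lia.
have [m [/eqP h1 /eqP h2 /eqP h3]] := median_exists x y u.
have [mx|mx] := eqVneq x m.
  (* Now [x] is between [y] and [u]; so is [x'], a step from [x] towards [y]. *)
  apply: (nearer_between_end uv yu); rewrite /between.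
  rewrite -mx in h3.
  have := dist_triangle conE x' y u; have := dist_triangle conE x x' u.
  have := distC symE conE y x; have := distC symE conE y x'.
  have := distC symE conE x x'; lia.
have [x2 xx2 dx2] := dist_step conE mx.
have dxx2 := dist_edge xx2.
have t1 := dist_triangle conE m x2 y; have t2 := dist_triangle conE m x2 u.
have t3 := dist_triangle conE x2 x y; have t4 := dist_triangle conE x2 x u.
have x2u : d x2 u < d x2 v.
  by apply: (nearer_between_end uv xu); rewrite /between; lia.
have [w [/eqP g1 /eqP g2 /eqP g3]] := median_exists x' x2 y.
have [x'2|x'2] := eqVneq x' x2; first by rewrite x'2.
have c0 := distC symE conE x x'; have c1 := distC symE conE w x2.
have t5 := dist_triangle conE x x' x2.
have t6 := dist_triangle conE w x y; have t7 := dist_triangle conE x' x w.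
(* Both [x'] and [x2] are equally far from [y], which the ends of an edge never are. *)
have x'2_neq1 : d x' x2 <> 1.
  move=> h; have := edge_dist_succ y (dist1_edge h).
  have := distC symE conE y x'; have := distC symE conE y x2; lia.
have x'2_neq0 : d x' x2 <> 0 by move/dist_eq0/eqP; rewrite (negPf x'2).
have wu : d w u < d w v by apply: (IHn x2 y) => //; rewrite /between; lia.
apply: (nearer_common_neighbour uv xx' _ _ xu wu); last lia.
by apply: (@dist1_edge _ _ conE); lia.
Qed.

(** Comparing [H x] with [H y] expresses convexity of [H] and of its complement at once. *)
Definition halfspace (H : pred V) : Prop :=
  forall x y z, btw x z y -> H x = H y -> H z = H x.

Lemma edge_halfspace u v : E u v -> halfspace (fun x => d x u < d x v).
Proof.
move=> uv x y z xzy; have vu : E v u by rewrite symE.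
have sx := edge_dist_succ x uv; have sy := edge_dist_succ y uv.
have [xu /esym yu|xu /esym yu] := boolP (d x u < d x v).
  exact: nearer_convex yu xzy.
apply/negbTE; rewrite -leqNgt ltnW //.
by apply: (nearer_convex vu _ _ xzy); lia.
Qed.

(** If [z] is nearer to [a], then [a] is between [z] and [b], so [H z = H b] would force
    [H a = H b]; the other case is symmetric. *)
Lemma halfspace_cut_edge H a b z : halfspace H -> E a b -> H a != H b ->
  (d z a < d z b) = (H z == H a).
Proof.
move=> hH ab Hab; have dab := dist_edge ab.
have dba := distC symE conE a b; have sz := edge_dist_succ z ab.
have [zab|zab] := ltnP (d z a) (d z b).
  have := hH z b a; rewrite /between => /(_ ltac:(lia)).
  by case: (H z) (H a) (H b) Hab => [] [] [] // _ /(_ erefl).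
have := hH z a b; rewrite /between => /(_ ltac:(lia)).
by case: (H z) (H a) (H b) Hab => [] [] [] // _ /(_ erefl).
Qed.

(* A nearest point of the other side is a gate. *)
Lemma halfspace_gate H v w : halfspace H -> H w != H v ->
  exists g, [/\ g != v & forall h, H h != H v -> btw v g h].
Proof.
move=> hH Hw.
case: (@arg_minnP _ w (fun h => H h != H v) (d v)) => // g Hg ming.
exists g; split=> [|h Hh]; first by apply: contraNneq Hg => ->.
(* Being between [g] and [h], this median is on their side; as [g] is nearest to [v] there, it
   equals [g]. *)
have [m [/eqP vmg vmh gmh]] := median_exists v g h.
have Hm : H m != H v.
  by rewrite (hH _ _ _ gmh) //; case: (H g) (H h) (H v) Hg Hh => [] [] [].
have := ming _ Hm => vgm.
by rewrite (_ : g = m) //; apply/esym/(@dist_eq0 _ _ conE); lia.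
Qed.

(* The vertex minimizing the sum of distances works: moving it to its gate in
   a halfspace containing most of the points would decrease the sum. *)
Lemma majority_vertex n (P : 'I_n -> V) : odd n ->
  exists m, forall H, halfspace H -> H m = (n < 2 * #|[set i | H (P i)]|).
Proof.
case: n P => // n P oddn.
case: (@arg_minnP _ (P ord0) predT (fun v => \sum_i d v (P i))) => // m _ minm.
exists m => H hH; apply/eqP/negPn/negP => Hm.
pose A := [set i | H (P i) != H m].
have cA : n.+1 < 2 * #|A|.
  have := cardsC [set i | H (P i)]; rewrite card_ord.
  have eA : A = if H m then ~: [set i | H (P i)] else [set i | H (P i)].
    apply/setP => i; rewrite /A; case: (H m); rewrite !inE;
    by case: (H (P i)).
  by rewrite eA; move: Hm; case: (H m) => /=; case: ltnP => //; lia.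
have /card_gt0P[i0] : 0 < #|A| by lia.
rewrite inE => Hi0; have [g [gm gateg]] := halfspace_gate hH Hi0.
have dgm : 0 < d m g.
  by rewrite lt0n; apply: contraNneq gm => /dist_eq0 ->.
(* Moving from [m] to [g] saves exactly [d m g] for each voter in [A] and costs each other voter at
   most [d m g]. *)
have le_sum : \sum_i (d g (P i) + (if i \in A then d m g else 0))
           <= \sum_i (d m (P i) + (if i \in ~: A then d m g else 0)).
  apply: leq_sum => i _; rewrite !inE.
  have [Hi|/gateg/eqP] := eqVneq (H (P i)) (H m) => /=; last lia.
  by have := dist_triangle conE m g (P i); have := distC symE conE m g; lia.
move: le_sum; rewrite !big_split -!big_mkcond /= !sum_nat_const.
have := cardsC A; have := minm g isT; rewrite card_ord.
move=> le_m cAC le_s; have : #|A| * d m g <= #|~: A| * d m g.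
  rewrite -(leq_add2l (\sum_i d m (P i))).
  by apply: leq_trans le_s; rewrite leq_add2r.
by rewrite leq_pmul2r //; lia.
Qed.

(** * Cuts given by the edges to the parents *)

Section Root.
Variable b : V.

(** The default [v] occurs only at the root; [tree_cut b] is then constantly false, a trivial
    halfspace. *)
Definition parent (v : V) : V :=
  odflt v [pick w | E v w && (d w b < d v b)].

Lemma parentP v : v != b -> E v (parent v) /\ d (parent v) b < d v b.
Proof.
move=> vb; rewrite /parent; case: pickP => [w /andP[]//|none].
have [w vw dw] := dist_step conE vb.
by have := none w; rewrite vw dw ltnS leqnn.
Qed.

Definition tree_cut (v x : V) : bool := d x v < d x (parent v).

Lemma tree_cut_halfspace v : halfspace (tree_cut v).
Proof.
rewrite /tree_cut /parent; case: pickP => [w /andP[vw _]|_] /=.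
  exact: edge_halfspace.
by move=> x y z _; rewrite !ltnn.
Qed.

(* Some tree edge crosses the halfspace of the first edge of a shortest path
   from x to y, and then defines the same halfspace. *)
Lemma tree_cut_separates x y : x != y ->
  exists2 v, v != b & tree_cut v x != tree_cut v y.
Proof.
move=> xy; have [u xu dxy] := dist_step conE xy.
pose H z := d z x < d z u; have hH : halfspace H by apply: edge_halfspace.
have Hxy : H x != H y.
  rewrite /H distxx (dist_edge xu) (distC symE conE y x) (distC symE conE y u).
  by rewrite dxy; lia.
(* If no parent edge crossed [H], following parents to the root would make [H] constant. *)
have [/forallP noncross|] :=
  boolP [forall v, (v != b) ==> (H v == H (parent v))].
  have Hb v : H v = H b.
    have [n] := ubnP (d v b); elim: n v => // n IHn v; rewrite ltnS => dv.
    have [->//|vb] := eqVneq v b; have [_ dp] := parentP vb.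
    by have /implyP/(_ vb)/eqP-> := noncross v; apply: IHn; lia.
  by rewrite !Hb eqxx in Hxy.
case/forallPn => v; rewrite negb_imply => /andP[vb Hv]; exists v => //.
have [vp _] := parentP vb.
rewrite /tree_cut !(halfspace_cut_edge _ hH vp Hv).
by case: (H x) (H y) (H v) Hxy => [] [] [].
Qed.

(** For an edge, one end [p] is between [z] and the other end [q]. Where a cut separates [p] from
    [q], convexity puts [z] on the side of [p]; elsewhere the box does, so [z = p]. Conversely, the
    first step of a shortest path from [x] to [y] lies in the box, so it is [y]. *)
Lemma edge_tree_cut_box x y :
  reflect (x != y /\ forall z,
     (forall v, v != b -> tree_cut v x = tree_cut v y ->
        tree_cut v z = tree_cut v x) -> z = x \/ z = y)
    (E x y).
Proof.
apply: (iffP idP) => [xy|[xy box]].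
  split=> [|z box]; first by apply: contraTneq xy => ->; rewrite irrE.
  have dxy := dist_edge xy; have dyx := distC symE conE x y.
  have sz := edge_dist_succ z xy.
  have sep p q : btw z p q -> (forall v, v != b ->
      tree_cut v p = tree_cut v q -> tree_cut v z = tree_cut v p) -> z = p.
    move=> zpq boxz; apply/eqP/negPn/negP => /tree_cut_separates[v vb].
    have := @tree_cut_halfspace v z q p zpq; have := boxz v vb.
    by case: (tree_cut v z) (tree_cut v p) (tree_cut v q) =>
      [] [] [] // h1 h2 _; (have := h1 erefl) || (have := h2 erefl).
  have [zx|zy] : btw z x y \/ btw z y x by rewrite /between; lia.
    by left; apply: sep zx box.
  by right; apply: sep zy _ => v vb yx; rewrite box.
have [u xu dxy] := dist_step conE xy.
have xuy : btw x u y by rewrite /between (dist_edge xu) dxy.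
have [] := box u.
- by move=> v _; apply: tree_cut_halfspace xuy.
- by move=> ux; rewrite ux irrE in xu.
- by move=> <-.
Qed.

End Root.
End MedianGraph.

(** * Majorities and orders coded by bits *)

Lemma majoritiesI n (A B : {set 'I_n}) :
  n < 2 * #|A| -> n < 2 * #|B| -> exists2 i, i \in A & i \in B.
Proof.
move=> cA cB; have cAB := cardsUI A B.
have cU : #|A :|: B| <= n by rewrite -[leqRHS]card_ord max_card.
have /card_gt0P[i /setIP[]] : 0 < #|A :&: B| by lia.
by exists i.
Qed.

Lemma majorityC n (A : {set 'I_n}) :
  odd n -> (n < 2 * #|~: A|) = ~~ (n < 2 * #|A|).
Proof.
move=> oddn; have := cardsC A; rewrite card_ord -leqNgt => cA.
by apply/idP/idP; lia.
Qed.

Section BitOrders.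
Variables (Y : finType) (rk : Y -> nat) (rk_inj : injective rk).

Definition bit_order (c : pred Y) : relation Y :=
  [set xy : Y * Y | if rk xy.1 < rk xy.2 then c xy.1
                    else (rk xy.2 < rk xy.1) && ~~ c xy.2].

Lemma bit_order_trans c x y z :
  (x, y) \in bit_order c -> (y, z) \in bit_order c -> (x, z) \in bit_order c.
Proof.
rewrite !inE /=; case: (ltngtP (rk x) (rk y)) => //= xy;
  case: (ltngtP (rk y) (rk z)) => //= yz;
  case: (ltngtP (rk x) (rk z)) => //= xz; try (by exfalso; lia);
  try (by move=> /negPf->).
by rewrite (rk_inj xz) => ->.
Qed.

Lemma bit_order_linear c : bit_order c \in linear_orders Y.
Proof.
rewrite inE; apply/and3P; split.
- by apply/forallP => x; rewrite inE /= ltnn.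
- apply/forallP => x; apply/forallP => y; apply/forallP => z.
  by apply/implyP => /andP[]; apply: bit_order_trans.
- apply/forallP => x; apply/forallP => y; apply/implyP => xy; rewrite !inE /=.
  case: (ltngtP (rk x) (rk y)) => [_|_|/rk_inj/eqP]; first exact: orbN.
    by rewrite orNb.
  by rewrite (negPf xy).
Qed.

(** Each pair is decided by the bit of its earlier element, and oddness excludes ties between a bit
    and its negation. *)
Lemma bit_order_majority n (c : 'I_n -> pred Y) (c' : pred Y) :
  odd n -> (forall y, c' y = (n < 2 * #|[set i | c i y]|)) ->
  majority (fun i => bit_order (c i)) = bit_order c'.
Proof.
move=> oddn maj; apply/setP => -[x y]; rewrite !inE /=.
under eq_finset => i do rewrite inE /=.
case: (ltngtP (rk x) (rk y)) => _ /=; last 1 first.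
- by rewrite (_ : [set _ | _] = set0) ?cards0 //; apply/setP => i; rewrite !inE.
- by rewrite maj.
rewrite maj -majorityC //; congr (_ < 2 * #|pred_of_set _|).
by apply/setP => i; rewrite !inE.
Qed.

(** At the element [x] of least [rk] on a cycle, the majorities for the pairs entering and leaving
    [x] share a voter, whose bit at [x] would be both false and true. *)
Lemma bit_order_majority_acyclic n (c : 'I_n -> pred Y) :
  acyclic (majority (fun i => bit_order (c i))).
Proof.
move=> [//|x0 s] cyc; set s' := x0 :: s in cyc *.
case: (@arg_minnP _ x0 (mem s') rk) => [|x xs minx]; first exact: mem_head.
have {}minx w : w \in s' -> rk x <= rk w by exact: minx.
have := next_cycle cyc xs; have := prev_cycle cyc xs.
have : rk x <= rk (next s' x) by rewrite minx ?mem_next.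
have : rk x <= rk (prev s' x) by rewrite minx ?mem_prev.
move: (next s' x) (prev s' x) => y z xz xy /=.
rewrite !inE => zxM xyM; have [i] := majoritiesI zxM xyM.
rewrite !inE /= ltnNge xz [rk y < rk x]ltnNge xy /=.
by case/andP=> _ /negPf->; rewrite if_same.
Qed.

(** The bit at [x] is read off the pair [(x, t)]; nothing comes after [t], so the bits elsewhere fix
    the order. *)
Lemma eq_bit_order (c c' : pred Y) t : (forall x, rk x <= rk t) ->
  (forall x, x != t -> c x = c' x) <-> bit_order c = bit_order c'.
Proof.
move=> tmax; have tlt x : x != t -> rk x < rk t.
  by move=> xt; rewrite ltn_neqAle tmax (inj_eq rk_inj) xt.
split=> [cc'|/setP cc' x xt]; last first.
  by have := cc' (x, t); rewrite !inE /= tlt.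
apply/setP => -[x y]; rewrite !inE /=; case: ltnP => [xy|_].
  by apply: cc'; apply: contraTneq xy => ->; rewrite -leqNgt.
case: ltnP => //= yx; rewrite cc' //.
by apply: contraTneq yx => ->; rewrite -leqNgt.
Qed.

Lemma bit_order_interval (c c1 c2 : pred Y) t : (forall x, rk x <= rk t) ->
  (bit_order c \in interval (bit_order c1) (bit_order c2)) <->
  (forall x, x != t -> c1 x = c2 x -> c x = c1 x).
Proof.
move=> tmax; have tlt x : x != t -> rk x < rk t.
  by move=> xt; rewrite ltn_neqAle tmax (inj_eq rk_inj) xt.
rewrite inE bit_order_linear /=; split=> [/subsetP sub x xt c12|box].
  have := sub (x, t); have := sub (t, x).
  rewrite !inE /= tlt // ltnNge ltnW ?tlt //= -c12 !andbb.
  by case: (c1 x) (c x) => [] [] // h1 h2; [have := h2 isT|have := h1 isT].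
apply/subsetP => -[x y]; rewrite !inE /=; case: ltnP => [xy|_].
  case/andP=> c1x c2x; rewrite box ?c1x ?c2x //.
  by apply: contraTneq xy => ->; rewrite -leqNgt.
case: ltnP => //= yx /andP[/negPf c1y /negPf c2y]; rewrite box ?c1y ?c2y //.
by apply: contraTneq yx => ->; rewrite -leqNgt.
Qed.

End BitOrders.

(** * The domain of a median graph *)

Theorem theorem5 (V : finType) (E : rel V) (hE : median_graph E) :
  exists (Y : finType) (D : {set relation Y}),
    [/\ #|Y| <= #|V|,
        condorcet_domain D,
        closed_domain D &
        graph_isomorphic (@domain_graph Y D) E].
Proof.
case: hE => -[symE irrE] conE medE; exists V.
have [b _|V0] := pickP (@predT V); last first.
  (* Without vertices there is no root; the empty domain is closed because an odd profile has a
     voter. *)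
  exists set0; split=> //.
  - split=> [|n P _]; first exact: sub0set.
    by case=> // v; have := V0 v.
  - case=> // n P _ /(_ ord0); rewrite inE //.
  - have no_order (R : {R : relation V | R \in set0}) : False.
      by case: R => R; rewrite inE.
    exists (fun R => False_rect V (no_order R)); split=> [|R]; last first.
      by case: (no_order R).
    by exists (fun v => False_rect _ (notF (esym (V0 v)))) => [R|v];
      [case: (no_order R)|have := V0 v].
(* Every [enum_rank] is below [#|V|], so this value puts [b] last. *)
pose rk v := if v == b then #|V| else enum_rank v : nat.
have rk_inj : injective rk.
  move=> x y; rewrite /rk; case: eqVneq => [->|_]; case: eqVneq => [->|_] //.
  - by move=> cV; have := ltn_ord (enum_rank y); rewrite -cV ltnn.
  - by move=> cV; have := ltn_ord (enum_rank x); rewrite cV ltnn.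
  - by move=> /ord_inj/enum_rank_inj.
have rk_max x : rk x <= rk b.
  by rewrite /rk eqxx; case: eqP => // _; apply: ltnW.
pose cut x v := tree_cut conE b v x.
pose R x := bit_order rk (cut x).
have R_inj : injective R.
  move=> x y /(eq_bit_order rk_inj _ _ rk_max) Rxy; apply/eqP/negPn/negP => xy.
  have [v vb] := tree_cut_separates symE irrE conE medE b xy.
  by rewrite [tree_cut _ _ _ _](Rxy v vb) eqxx.
pose D : {set relation V} := [set R x | x : V].
have profileE n (P : 'I_n -> relation V) : profile_over D P ->
    exists p : 'I_n -> V, majority P = majority (fun i => R (p i)).
  move=> PD; have PR i : {x | P i = R x}.
    by apply/sig_eqW; case/imsetP: (PD i) => x _ ->; exists x.
  exists (fun i => sval (PR i)); apply/setP => xy; rewrite !inE.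
  by under eq_finset => i do rewrite (svalP (PR i)).
exists D; split=> //.
- split=> [|n P /profileE[p ->]]; last exact: bit_order_majority_acyclic.
  by apply/subsetP => _ /imsetP[x _ ->]; apply: bit_order_linear.
- move=> n P oddn /profileE[p ->].
  have [m maj] := majority_vertex symE conE medE p oddn.
  apply/imsetP; exists m => //; apply: bit_order_majority => // v.
  by apply: (maj (tree_cut conE b v)); exact: tree_cut_halfspace.
have RD x : R x \in D by apply: imset_f.
pose g x : {Q : relation V | Q \in D} := exist _ (R x) (RD x).
have g_bij : bijective g.
  apply: inj_card_bij => [x y /(congr1 val)/R_inj//|].
  by rewrite card_sig card_imset.
have [f fK gK] := g_bij; exists f; split=> [|Q Q']; first by exists g.
rewrite -(gK Q) -(gK Q') !fK; move: (f Q) (f Q') => x y.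
have Dbox z : (R z \in interval (R x) (R y)) <-> (forall v, v != b ->
    tree_cut conE b v x = tree_cut conE b v y ->
    tree_cut conE b v z = tree_cut conE b v x).
  exact: bit_order_interval.
apply/(edge_tree_cut_box symE irrE conE medE b)/andP.
  case=> xy box; split; first by apply: contra_neq xy => /(congr1 val)/R_inj.
  apply/eqP/setP => Q0; rewrite in_setI in_set2 /=.
  apply/andP/orP => [[Q0xy /imsetP[z _ Q0z]]|[] /eqP ->].
  - by move: Q0xy; rewrite Q0z => /Dbox/box[]->; rewrite eqxx; [left|right].
  - by split=> //; apply/Dbox.
  - by split=> //; apply/Dbox => v _ ->.
case=> gxy /eqP/setP Dxy; split=> [|z /Dbox zxy].
  by apply: contra_neq gxy => ->.
by have := Dxy (R z); rewrite in_setI zxy RD in_set2 => /esym/orP[]/eqP/R_inj;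
  [left|right].
Qed.
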